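(* For any increasing range map $\delta$ and $n\geq0$, the poset $\mathsf{Ca}_\delta(n)$ is (i) straight; (ii) coated; (iii) nested (when $n\geq1$); (iv) EL-shellable; (v) a meet semi-sublattice of $\mathsf{Cl}_\delta(n)$; (vi) a lattice; (vii) constructible by interval doubling.
   Context: $\mathbb{N}=\{0,1,2,\dots\}$, $[n]=\{1,\dots,n\}$. A range map is a map $\delta:\mathbb{N}\setminus\{0\}\to\mathbb{N}$; it is increasing if $\delta(i)<\delta(i+1)$ for all $i\geq1$. A $\delta$-cliff of size $n$ is a word $u=u_1\cdots u_n$ of nonnegative integers with $u_i\leq\delta(i)$ for all $i$; $\mathsf{Cl}_\delta(n)$ is the set of them, ordered componentwise ($u\preccurlyeq v$ iff $u_i\leq v_i$ for all $i$); it is a lattice with componentwise min and max as meet and join. $\mathsf{Ca}_\delta(n)$ is the set of $\delta$-cliffs $u$ of size $n$ ($\delta$-canyons) such that $u_{i-j}\leq u_i-j$ for all $i\in[n]$ and all $j\in[u_i]$ with $i-j\geq1$, with the induced order. A meet semi-sublattice of $\mathsf{Cl}_\delta(n)$ is a subset closed under the meet of $\mathsf{Cl}_\delta(n)$. For a subposet $\mathcal{P}$ of $\mathsf{Cl}_\delta(n)$: - $\mathcal{P}$ is straight if whenever $v$ covers $u$ in $\mathcal{P}$, the words $u$ and $v$ differ at exactly one position. - $\mathcal{P}$ is coated if for all $u\preccurlyeq v$ in $\mathcal{P}$ and all $i\in[n-1]$, $u_1\cdots u_iv_{i+1}\cdots v_n\in\mathcal{P}$. - (For $n\geq1$ and $\mathcal{P}$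 nonempty.) Let $\mathrm{m}(\mathcal{P}):=\max\{u_n:u\in\mathcal{P}\}$, $\mathcal{P}_a:=\{u\in\mathcal{P}:u_n=a\}$, and $\mathcal{P}_{a,b}:=\{wb:wa\in\mathcal{P}_a\}$ (replace the last letter $a$ by $b$). $\mathcal{P}$ is nested if for every $a\in\{0,\dots,\mathrm{m}(\mathcal{P})\}$, the word $0^{n-1}a$ belongs to $\mathcal{P}$, and $\mathcal{P}_{a,\mathrm{m}(\mathcal{P})}$ is both a subset and an interval of $\mathcal{P}$ (i.e. of the form $\{z\in\mathcal{P}:x\preccurlyeq z\preccurlyeq y\}$ for some $x,y\in\mathcal{P}$). EL-shellability. Let $\lambda$ be a map from the covering pairs of a poset $\mathcal{P}$ to a poset $\Lambda$. The label sequence of a saturated chain is the sequence of labels of its successive covering pairs; the chain is $\lambda$-increasing if this sequence is strictly increasing. $\lambda$ is an EL-labeling if for all $x\preccurlyeq y$ in $\mathcal{P}$ there is exactly one $\lambda$-increasing saturated chain from $x$ to $y$, and its label sequence is lexicographically minimal among those of all saturated chains from $x$ to $y$. $\mathcal{P}$ is EL-shellable if it has a least and a greatest element and admits an EL-labeling for some poset $\Lambda$. Interval doubling. Let $\mathbf{2}$ be the chain $\{0<1\}$. For an interval $I$ of a poset $(\mathcal{P},\preccurlyeq)$, $\mathcal{P}[I]:=(\mathcal{P}\setminus I)\sqcup(I\times\mathbf{2})$, ordered as follows: elements are compared through their underlying elements of $\mathcal{P}$ (the underlying element of $(x,a)$ being $x$), except that $(x,a)\leq(y,b)$ for $x,y\in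 I$ iff $x\preccurlyeq y$ and $a\leq b$. A lattice is constructible by interval doubling if it is isomorphic to a poset obtained from the one-element lattice by a finite sequence of interval doublings. *)

(* Defs.v *)
From HB Require Import structures.
From mathcomp Require Import all_boot all_order.
Set Implicit Arguments.
Unset Strict Implicit.
Unset Printing Implicit Defensive.
Import Order.Theory.
(* The order of [n.-tuple nat] is the componentwise one. *)
Import Order.DefaultTupleProdOrder.
Local Open Scope order_scope.

(** * Finite posets *)

Section Subposet.
Context (d : Order.disp_t) (T : finPOrderType d).

Definition subposet (P : {set T}) : Type := {x : T | x \in P}.

Variable P : {set T}.
HB.instance Definition _ := SubFinite.on (subposet P).
HB.instance Definition _ := [SubChoice_isSubPOrder of subposet P by <: with d].
End Subposet.

Section Posets.
Context (d : Order.disp_t) (T : finPOrderType d).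

Definition covers : rel T :=
  [rel x y | (x < y) && [forall z : T, ~~ (x < z < y)]].

(* [x :: s] is a saturated chain from [x] to [y]. *)
Definition saturated (x : T) (s : seq T) (y : T) : bool :=
  path covers x s && (last x s == y).

Definition labels (L : Type) (lam : T -> T -> L) (x : T) (s : seq T) : seq L :=
  pairmap lam x s.

(* A labeling is a total function of two arguments, but only its values on
   covering pairs are ever used.  In [seqlexi L], words are compared
   lexicographically for the given order of [L], a proper prefix being
   smaller; the increasing chain is required to be the least one, that is, to
   precede all the others, even when [L] is not totally ordered. *)
Definition EL_labeling (d' : Order.disp_t) (L : porderType d')
    (lam : T -> T -> L) : Prop :=
  forall x y : T, x <= y ->
  exists s : seq T,
    [/\ saturated x s y,
        sorted <%O (labels lam x s),
        forall t : seq T, saturated x t y -> sorted <%O (labels lam x t) ->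
          t = s
      & forall t : seq T, saturated x t y ->
          (labels lam x s : seqlexi L) <= (labels lam x t : seqlexi L)].

Definition EL_shellable : Prop :=
  [/\ exists b : T, forall x : T, b <= x,
      exists t : T, forall x : T, x <= t
    & exists (d' : Order.disp_t) (L : porderType d') (lam : T -> T -> L),
        EL_labeling lam].
End Posets.

Definition is_lattice (d : Order.disp_t) (T : porderType d) : Prop :=
  forall x y : T,
    (exists m : T, forall z : T, (z <= m) = (z <= x) && (z <= y)) /\
    (exists j : T, forall z : T, (j <= z) = (x <= z) && (y <= z)).

Definition poset_iso (d d' : Order.disp_t)
    (T : porderType d) (U : porderType d') : Prop :=
  exists2 f : T -> U, bijective f & {mono f : x y / x <= y}.

(** * Interval doubling *)

Section Doubling.
Context (d : Order.disp_t) (T : porderType d).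

Definition in_itv (a b : T) : pred T := [pred x | a <= x <= b].

(* [(T \ I) + I * 2] where [I] is the interval between [a] and [b], 0
   being [false] and 1 being [true]. *)
Definition doubling (a b : T) : Type :=
  ({x : T | ~~ in_itv a b x} + {x : T | in_itv a b x} * bool)%type.

Variables a b : T.
Implicit Types p q r : doubling a b.

Definition under p : T :=
  match p with inl x => val x | inr (x, _) => val x end.

Definition doubling_le p q : bool :=
  (under p <= under q) &&
  match p, q with inr (_, i), inr (_, j) => i ==> j | _, _ => true end.

Fact doubling_refl : reflexive doubling_le.
Proof. by case=> [x|[x i]]; rewrite /doubling_le lexx /= ?implybb. Qed.

Fact doubling_anti : antisymmetric doubling_le.
Proof.
move=> p q /andP[/andP[pq ij] /andP[qp ji]].
have {pq qp} : under p = under q by apply/le_anti; rewrite pq qp.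
case: p q ij ji => [x|[x i]] [y|[y j]] /= ij ji exy.
- by congr inl; apply: val_inj.
- by have := valP x; rewrite /= exy (valP y : in_itv _ _ _).
- by have := valP y; rewrite /= -exy (valP x : in_itv _ _ _).
- by congr (inr (_, _)); [apply: val_inj | case: i j ij ji => [] []].
Qed.

Fact doubling_trans : transitive doubling_le.
Proof.
move=> q p r /andP[pq ij] /andP[qr jk].
rewrite /doubling_le (le_trans pq qr) /=.
case: p r q pq qr ij jk => [x|[x i]] [z|[z k]] //= [y|[y j]] /= xy yz ij jk.
- case/negP: (valP y).
  have /andP[ax _] := valP x; have /andP[_ zb] := valP z.
  by apply/andP; split; [apply: le_trans ax xy | apply: le_trans yz zb].
- by case: i j k ij jk => [] [] [].
Qed.

HB.instance Definition _ := Choice.on (doubling a b).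
HB.instance Definition _ := Order.Le_isPOrder.Build d (doubling a b)
  doubling_refl doubling_anti doubling_trans.
End Doubling.

Inductive iterated_doubling : forall d : Order.disp_t, porderType d -> Prop :=
| doubling_one : iterated_doubling 'I_1
| doubling_step (d : Order.disp_t) (T : porderType d) (a b : T) :
    iterated_doubling T -> a <= b -> iterated_doubling (doubling a b).

Definition constructible_by_interval_doubling
    (d : Order.disp_t) (T : porderType d) : Prop :=
  exists (d' : Order.disp_t) (U : porderType d'),
    iterated_doubling U /\ poset_iso U T.

(** * Cliffs and canyons *)

(* Range maps are defined on positive integers: the value at 0 is junk. *)
Definition increasing_range_map (delta : nat -> nat) : Prop :=
  forall i : nat, (1 <= i)%N -> (delta i < delta i.+1)%N.

(* The letters of a word are numbered from 1. *)
Definition letter (u : seq nat) (i : nat) : nat := nth 0%N u i.-1.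

Definition is_cliff (delta : nat -> nat) (u : seq nat) : bool :=
  all (fun i => letter u i <= delta i)%N (iota 1 (size u)).

Record cliff (delta : nat -> nat) (n : nat) : Type :=
  Cliff { word :> n.-tuple nat; _ : is_cliff delta word }.

Section Cliffs.
Variables (delta : nat -> nat) (n : nat).
Local Notation Cl := (cliff delta n).

HB.instance Definition _ := [isSub for @word delta n].
HB.instance Definition _ := [Choice of Cl by <:].

Let B := (\max_(i < n) delta i.+1)%N.

Let cliff_code (u : Cl) : {ffun 'I_n -> 'I_B.+1} :=
  [ffun i => inord (tnth (word u) i)].
Let cliff_decode (f : {ffun 'I_n -> 'I_B.+1}) : option Cl :=
  insub [tuple (f i : nat) | i < n].

Fact is_cliffP (u : n.-tuple nat) :
  reflect (forall i : 'I_n, tnth u i <= delta i.+1)%N (is_cliff delta u).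
Proof.
rewrite /is_cliff size_tuple; apply: (iffP allP) => [h i|h i].
  by have := h i.+1; rewrite mem_iota /= add1n ltnS ltn_ord (tnth_nth 0%N) => ->.
rewrite mem_iota; case: i => // i; rewrite add1n ltnS /= => lt_in.
by have := h (Ordinal (lt_in : i < n)%N); rewrite (tnth_nth 0%N).
Qed.

Fact cliff_codeK : pcancel cliff_code cliff_decode.
Proof.
move=> u; rewrite /cliff_decode.
have -> : [tuple (cliff_code u i : nat) | i < n] = word u.
  apply: eq_from_tnth => i; rewrite tnth_mktuple ffunE inordK // ltnS.
  have /is_cliffP/(_ i)/leq_trans : is_cliff delta (word u) by case: u.
  by apply; apply: (@leq_bigmax _ (fun i : 'I_n => delta i.+1)).
exact: valK.
Qed.

HB.instance Definition _ : isCountable Cl := PCanIsCountable cliff_codeK.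
HB.instance Definition _ : isFinite Cl := PCanIsFinite cliff_codeK.

Fact cliff_meet_closed : meet_closed (fun u : n.-tuple nat => is_cliff delta u).
Proof.
move=> u v /is_cliffP hu _; apply/is_cliffP => i.
by rewrite tnth_meet; apply: leq_trans (geq_minl _ _) (hu i).
Qed.

Fact cliff_join_closed : join_closed (fun u : n.-tuple nat => is_cliff delta u).
Proof.
move=> u v /is_cliffP hu /is_cliffP hv; apply/is_cliffP => i.
by rewrite tnth_join -[_ `|` _]/(maxn _ _) geq_max hu hv.
Qed.

(* The lattice of cliffs is a sublattice of [n.-tuple nat]; in particular its
   meet and join are the componentwise minimum and maximum. *)
HB.instance Definition _ :=
  [SubChoice_isSubPOrder of Cl by <: with Order.Disp tt tt].
HB.instance Definition _ := Order.SubPOrder_isSubLattice.Build _ _ _ _ Cl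
  cliff_meet_closed cliff_join_closed.

Fact cliff_leE (u v : Cl) :
  (u <= v) = [forall i : 'I_n, tnth (word u) i <= tnth (word v) i]%N.
Proof. by rewrite -Order.le_val; apply: leEtprod. Qed.

End Cliffs.

Section Subposets.
Variables (delta : nat -> nat) (n : nat).
Local Notation Cl := (cliff delta n).

Definition canyons : {set Cl} :=
  [set u : Cl |
    all (fun i =>
      all (fun j => (1 <= i - j) ==> (letter u (i - j) <= letter u i - j))
          (iota 1 (letter u i)))
      (iota 1 n)]%N.

Variable P : {set Cl}.

(* The meet is the one of the lattice of cliffs. *)
Definition meet_subsemilattice : Prop :=
  {in P &, forall u v : Cl, u `&` v \in P}.

Definition straight : Prop :=
  forall u v : subposet P, covers u v ->
    #|[set i : 'I_n | tnth (word (val u)) i != tnth (word (val v)) i]| = 1%N.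

(* Words are compared with the elements of a set of cliffs as sequences, so
   that [w \in words_of Q] is meaningful for any word [w]. *)
Definition words_of (Q : {set Cl}) : seq (seq nat) :=
  [seq (word u : seq nat) | u in Q].

Definition coated : Prop :=
  forall u v : Cl, u \in P -> v \in P -> u <= v ->
  forall i : nat, (1 <= i <= n.-1)%N -> take i u ++ drop i v \in words_of P.

Definition max_letter : nat := (\max_(u in P) letter u n)%N.

Definition fiber (a : nat) : {set Cl} := [set u in P | letter u n == a].

(* The words [w b] such that [w a] is in [P]. *)
Definition relast (a b : nat) : seq (seq nat) :=
  [seq rcons (take n.-1 u) b | u : Cl in fiber a].

(* Only meaningful for [0 < n] and [P] nonempty. *)
Definition nested : Prop :=
  forall a : nat, (a <= max_letter)%N ->
    [/\ rcons (nseq n.-1 0%N) a \in words_of P,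
        {subset relast a max_letter <= words_of P}
      & exists x y : Cl, [/\ x \in P, y \in P
          & relast a max_letter =i words_of [set z in P | x <= z <= y]]].
End Subposets.

(* Main.v *)
Require Import Defs.
From mathcomp Require Import all_boot all_order.
From mathcomp Require Import zify.

(** Number the letters of a word from 0. A word [w] is a canyon when
    [w_k + (i - k) <= w_i] as soon as [k < i] and [i - k <= w_i]: the letter at
    [i] reaches back over [w_i] positions and bounds the letters found there.
    Lowering the letters before [i] keeps these inequalities. So the componentwise
    minimum of two canyons satisfies those at [i] because the word with the
    smaller letter there does, and if [u <= v] are canyons then following the
    first letters of [u] by the last ones of [v] gives a canyon: the set of
    canyons is closed under meets and coated.

    Coatedness alone gives straightness and the labeling. Between [x < y] there
    is always the word obtained from [y] by giving its first letters the values
    they have in [x], so [y] can be approached by changing one letter of [x], the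
    last one at which they differ ([coated_step]). Hence a cover changes a single
    letter, and labeling the change at position [p] of a letter of value [c] by
    [(n - p, c)], in lexicographic order, makes the chain that always changes the
    last possible letter both the only increasing one and the least one
    ([EL_criterion], [coated_EL_labeling]).

    As [delta] increases, [delta 1 .. delta n] is itself a canyon, hence a
    greatest element, and a finite meet semilattice with a greatest element is a
    lattice ([meets_top_lattice]).

    For the doublings, let [m] be [delta n.+1]. A canyon [w] of size [n] can be
    followed by [m], and by a smaller letter [a] exactly when [w] lies below one
    particular canyon [cap n a] ([fitsP]). So the words [w m] such that [w a] is a
    canyon form an interval, which is nestedness. Starting from the canyons that
    end with [m], a copy of the canyons of size [n], add those ending with 0,
    then those ending with 1, and so on: each addition doubles one of these
    intervals, [w a] being the lower copy of [w m] ([layerS_constructible]). *)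

Set Implicit Arguments.
Unset Strict Implicit.
Unset Printing Implicit Defensive.
Import Order.Theory.

(** * Finite posets *)

Section Posets.
Local Open Scope order_scope.
Context (d : Order.disp_t) (T : finPOrderType d).

Lemma covers_lt (x y : T) : covers x y -> x < y.
Proof. by case/andP. Qed.

Lemma covers_between (x y z : T) : covers x y -> x < z -> z <= y -> z = y.
Proof.
move=> /andP[_ /forallP/(_ z)]; rewrite negb_and => + lt_xz; rewrite lt_xz /=.
by move=> /negbTE nlt_zy; rewrite le_eqVlt nlt_zy orbF => /eqP.
Qed.

Lemma saturated_cons (x y z : T) s :
  saturated x (z :: s) y = covers x z && saturated z s y.
Proof. by rewrite /saturated /= andbA. Qed.

Lemma saturated_le (x y : T) s : saturated x s y -> x <= y.
Proof.
elim: s x => [|z s IH] x; first by rewrite /saturated /= => /eqP->.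
by rewrite saturated_cons => /andP[/covers_lt/ltW/le_trans + /IH]; apply.
Qed.

Lemma saturated_loop (x : T) s : saturated x s x -> s = [::].
Proof.
case: s => // z s; rewrite saturated_cons => /andP[/covers_lt lt_xz].
by move=> /saturated_le/(lt_le_trans lt_xz); rewrite ltxx.
Qed.

(** A local test. Call greedy the chain that steps from [x] to the [z] of the
    hypothesis. The first inequality makes it least, and the last one makes it
    increasing. An increasing chain that starts with [w != z] continues, by
    induction, along the greedy chain from [w] to [y], whose first label is at
    most that of the step to [v], hence below that of the step to [w]: a
    contradiction. *)
Lemma EL_criterion (d' : Order.disp_t) (L : porderType d') (lam : T -> T -> L) :
  (forall x y : T, x < y ->
   exists z : T,
    [/\ covers x z, z <= y,
        forall w : T, covers x w -> w <= y -> w != z -> lam x z < lam x w /\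
          exists v : T, [/\ covers w v, v <= y & lam w v < lam x w]
      & forall w : T, covers z w -> w <= y -> lam x z < lam z w]) ->
  EL_labeling lam.
Proof.
move=> greedy x y le_xy.
have [m] := ubnP #|[set z | x <= z]|; elim: m x le_xy => // m IH x le_xy lt_m.
have [->|neq_xy] := eqVneq x y.
  exists [::]; split=> //; first by rewrite /saturated /= eqxx.
  by move=> t /saturated_loop.
have lt_xy : x < y by rewrite lt_neqAle neq_xy.
have above_lt w : x < w -> (#|[set z | (w <= z)%O]| < m)%N.
  move=> lt_xw; rewrite -ltnS; apply: leq_trans lt_m.
  rewrite ltnS; apply/proper_card/properP; split.
    by apply/subsetP => z; rewrite !inE; apply: le_trans (ltW lt_xw).
  by exists x; rewrite inE ?lexx // lt_geF.
have [z [cov_xz le_zy first second]] := greedy _ _ lt_xy.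
have [s [sat_s inc_s uniq_s min_s]] := IH z le_zy (above_lt z (covers_lt cov_xz)).
have sat_zs : saturated x (z :: s) y by rewrite saturated_cons cov_xz.
exists (z :: s); split=> //.
- case: s sat_s inc_s {uniq_s min_s sat_zs} => //= w s.
  rewrite saturated_cons => /andP[cov_zw /saturated_le le_wy] ->.
  by rewrite second.
- case=> [|w t]; first by rewrite /saturated /= (negbTE neq_xy).
  rewrite saturated_cons => /andP[cov_xw sat_t] inc_t.
  have le_wy := saturated_le sat_t.
  have [e|neq_wz] := eqVneq w z.
    by rewrite e in sat_t inc_t *; rewrite (uniq_s t sat_t (path_sorted inc_t)).
  have [_ [v [cov_wv le_vy lt_v]]] := first w cov_xw le_wy neq_wz.
  have [s' [sat_s' inc_s' uniq_s' min_s']] :=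
    IH w le_wy (above_lt w (covers_lt cov_xw)).
  have e := uniq_s' t sat_t (path_sorted inc_t).
  have [tv [sat_tv _ _ _]] := IH v le_vy
    (above_lt v (lt_trans (covers_lt cov_xw) (covers_lt cov_wv))).
  have := min_s' (v :: tv); rewrite saturated_cons cov_wv -e => /(_ sat_tv).
  case: t sat_t inc_t {e} => [|w' t] sat_t inc_t.
    move: sat_t; rewrite /saturated /= => /eqP e.
    by have := lt_le_trans (covers_lt cov_wv) le_vy; rewrite e ltxx.
  case/andP: inc_t => lt_w' _; rewrite /labels /= lexi_cons => /andP[le_w' _].
  by have := lt_trans (lt_le_trans lt_w' le_w') lt_v; rewrite ltxx.
- case=> [|w t]; first by rewrite /saturated /= (negbTE neq_xy).
  rewrite saturated_cons => /andP[cov_xw sat_t].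
  rewrite /labels /= lexi_cons.
  have [e|neq_wz] := eqVneq w z.
    by rewrite e in sat_t *; rewrite lexx; apply: min_s.
  have [lt_lam _] := first w cov_xw (saturated_le sat_t) neq_wz.
  by rewrite ltW // lt_geF.
Qed.

(** The join is an upper bound with as few elements below it as possible: its
    meet with any other upper bound cannot be strictly smaller. *)
Lemma meets_top_lattice (t : T) :
  (forall x, x <= t) ->
  (forall x y : T, exists m, forall z, (z <= m) = (z <= x) && (z <= y)) ->
  is_lattice T.
Proof.
move=> le_t meets x y; split; first exact: meets.
pose ub := [pred z | (x <= z) && (y <= z)].
have ub_t : ub t by rewrite /= !le_t.
case: (@arg_minnP _ t ub (fun j => #|[set w | w <= j]|) ub_t) => j ub_j min_j.
exists j => z; apply/idP/idP => [le_jz|ub_z].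
  by case/andP: ub_j => /le_trans-> // /le_trans->.
have [m mP] := meets j z.
have ub_m : ub m.
  by case/andP: ub_j => xj yj; case/andP: ub_z => xz yz; rewrite /= !mP xj xz yj.
have /andP[le_mj le_mz] : (m <= j) && (m <= z) by rewrite -mP.
have /eqP <- // : m == j.
apply: contraTT (min_j m ub_m) => neq_mj; rewrite -ltnNge.
apply/proper_card/properP; split.
  by apply/subsetP => w; rewrite !inE => /le_trans; apply.
by exists j; rewrite inE ?lexx // lt_geF // lt_neqAle neq_mj.
Qed.

End Posets.

(** * Coated sets of cliffs *)

Section Coated.
Variables (delta : nat -> nat) (n : nat).
Local Notation Cl := (cliff delta n).

Lemma cliff_leP (u v : Cl) :
  reflect (forall i, nth 0 (word u) i <= nth 0 (word v) i) (u <= v)%O.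
Proof.
rewrite cliff_leE; apply: (iffP forallP) => h i; last by rewrite !(tnth_nth 0).
have [lt_in|le_ni] := ltnP i n; last by rewrite nth_default ?size_tuple.
by have := h (Ordinal lt_in); rewrite !(tnth_nth 0).
Qed.

Lemma cliff_ext (u v : Cl) :
  (forall i, nth 0 (word u) i = nth 0 (word v) i) -> u = v.
Proof. by move=> h; apply/le_anti/andP; split; apply/cliff_leP => i; rewrite h. Qed.

Variable P : {set Cl}.
Local Notation T := (subposet P).
Implicit Types x y z : T.
Local Notation at_ x i := (nth 0 (word (val x)) i).

Lemma subposet_leP x y : reflect (forall i, at_ x i <= at_ y i) (x <= y)%O.
Proof. by rewrite -Order.le_val; apply: cliff_leP. Qed.

Lemma subposet_ext x y : (forall i, at_ x i = at_ y i) -> x = y.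
Proof. by move=> h; apply/val_inj/cliff_ext. Qed.

Lemma differ_bound x y p : at_ x p < at_ y p -> p < n.
Proof. by apply: contraTltn => le_np; rewrite !nth_default ?size_tuple. Qed.

Lemma last_difference x y : (x < y)%O ->
  exists p, at_ x p < at_ y p /\ forall i, p < i -> at_ x i = at_ y i.
Proof.
move=> lt_xy; have le_xy := subposet_leP _ _ (ltW lt_xy).
have ex : exists i, at_ x i != at_ y i.
  have [/existsP[i ne]|/existsPn eq_xy] :=
    boolP [exists i : 'I_n, at_ x i != at_ y i]; first by exists i.
  move: lt_xy; rewrite (_ : x = y) ?ltxx //; apply: subposet_ext => i.
  have [lt_in|le_ni] := ltnP i n; last by rewrite !nth_default ?size_tuple.
  by have := eq_xy (Ordinal lt_in); rewrite negbK => /eqP.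
have bound i : at_ x i != at_ y i -> i <= n.
  by apply: contraR; rewrite -ltnNge => lt_ni; rewrite !nth_default // size_tuple ltnW.
case: (ex_maxnP ex bound) => p ne_p max_p; exists p; split.
  by rewrite ltn_neqAle ne_p le_xy.
by move=> i; apply: contraTeq => /max_p; rewrite -leqNgt.
Qed.

Hypothesis coatedP : coated P.

(** Cutting before the first letter or after the last one gives [y] or [x]. *)
Lemma coated_graft x y p : (x <= y)%O ->
  exists z, forall i, at_ z i = if i < p then at_ x i else at_ y i.
Proof.
move=> le_xy; have [p0|p_gt0] := posnP p; first by exists y => i; rewrite p0.
have [lt_pn|le_np] := ltnP p n; last first.
  exists x => i; case: ltnP => // le_pi.
  by rewrite !nth_default // size_tuple (leq_trans le_np).
have /imageP[z zP def_z] : take p (val x) ++ drop p (val y) \in words_of P.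
  apply: coatedP; rewrite ?(valP x) ?(valP y) ?Order.le_val //; lia.
exists (Sub z zP) => i; rewrite /= -def_z nth_cat size_take size_tuple lt_pn.
by case: ltnP => le_pi; rewrite ?nth_take // nth_drop subnKC.
Qed.

(** Grafting [x] before [p] and [y] from [p] on changes [x] at [p] only. Among
    the elements below [y] that do so, one with the least letter at [p] covers
    [x]. *)
Lemma coated_step x y p : (x <= y)%O -> at_ x p < at_ y p ->
    (forall i, p < i -> at_ x i = at_ y i) ->
  exists z, [/\ covers x z, (z <= y)%O, at_ x p < at_ z p
              & forall i, i != p -> at_ x i = at_ z i].
Proof.
move=> le_xy lt_p eq_gt; have [g gP] := coated_graft p le_xy.
pose Q := [pred z : T | [&& (x < z)%O, (z <= y)%O, at_ x p < at_ z p
                          & [forall i : 'I_n, (i != p :> nat) ==> (at_ x i == at_ z i)]]].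
have QP z : reflect [/\ (x < z)%O, (z <= y)%O, at_ x p < at_ z p
              & forall i, i != p -> at_ x i = at_ z i] (Q z).
  apply: (iffP and4P) => -[xz zy xp h]; split=> //.
    move=> i; have [lt_in ne|le_ni] := ltnP i n; last by rewrite !nth_default ?size_tuple.
    by have /forallP/(_ (Ordinal lt_in))/implyP/(_ ne)/eqP := h.
  by apply/forallP => i; apply/implyP => ne; rewrite h.
have Qg : Q g.
  have gp : at_ g p = at_ y p by rewrite gP ltnn.
  have gi i : i != p -> at_ x i = at_ g i.
    by rewrite gP; case: ltngtP => // /eq_gt.
  have le_x := subposet_leP _ _ le_xy.
  apply/QP; split; rewrite ?gp //.
    rewrite lt_neqAle; apply/andP; split.
      by apply: contraTneq lt_p => ->; rewrite gp ltnn.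
    by apply/subposet_leP => i; rewrite gP; case: ifP.
  by apply/subposet_leP => i; rewrite gP; case: ifP.
case: (arg_minnP (fun z => at_ z p) Qg) => z /QP[xz zy xp eq_z] min_z.
exists z; split=> //; rewrite /covers /= xz; apply/forallP => c.
apply/negP => /andP[xc cz].
have lex := subposet_leP _ _ (ltW xc); have lez := subposet_leP _ _ (ltW cz).
have eq_c i : i != p -> at_ x i = at_ c i.
  move=> ne; have := lex i; have := lez i; rewrite -(eq_z _ ne) => le_cx le_xc.
  by apply/eqP; rewrite eqn_leq le_cx le_xc.
have xcp : at_ x p < at_ c p.
  rewrite ltn_neqAle lex andbT; apply: contraTneq xc => e.
  rewrite (_ : x = c) ?ltxx //; apply: subposet_ext => i.
  by have [->|/eq_c] := eqVneq i p.
have Qc : Q c by apply/QP; split=> //; apply: le_trans zy; apply: ltW.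
suff le_zc : (z <= c)%O by rewrite (le_gtF le_zc) in cz.
apply/subposet_leP => i.
by have [->|ne] := eqVneq i p; [apply: min_z | rewrite -eq_z ?eq_c].
Qed.

Lemma coated_cover x y : covers x y ->
  exists p, at_ x p < at_ y p /\ forall i, i != p -> at_ x i = at_ y i.
Proof.
move=> cov_xy; have lt_xy := covers_lt cov_xy.
have [p [lt_p eq_gt]] := last_difference lt_xy.
have [z [/covers_lt cov_xz le_zy lt_z eq_z]] := coated_step (ltW lt_xy) lt_p eq_gt.
by exists p; rewrite -(covers_between cov_xy cov_xz le_zy).
Qed.

Lemma coated_straight : straight P.
Proof.
move=> x y /coated_cover[p [lt_p eq_ne]].
have lt_pn := differ_bound lt_p.
rewrite -[1](cards1 (Ordinal lt_pn)); congr #|pred_of_set _|.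
apply/setP => i; rewrite !inE !(tnth_nth 0) -val_eqE /=.
by have [->|/eq_ne->] := eqVneq (val i) p; rewrite ?eqxx // neq_ltn lt_p.
Qed.

(** On a covering pair the range is a single position, which the maximum merely
    extracts. *)
Definition moved x y := \max_(i < n | at_ x i != at_ y i) i.

(** Counting positions from the end makes changes further to the right
    smaller. *)
Definition step_label x y : nat *l nat := (n - moved x y, at_ x (moved x y)).

Lemma movedE x y p : at_ x p < at_ y p ->
  (forall i, i != p -> at_ x i = at_ y i) -> moved x y = p.
Proof.
move=> lt_p eq_ne.
have lt_pn := differ_bound lt_p.
rewrite /moved (big_pred1 (Ordinal lt_pn)) // => i; rewrite /= -val_eqE /=.
by have [->|/eq_ne->] := eqVneq (val i) p; rewrite ?eqxx // neq_ltn lt_p.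
Qed.

Lemma step_label_lt x y z w p q : moved x y = p -> moved z w = q ->
    (q < p < n) || (q == p) && (at_ x p < at_ z p) ->
  (step_label x y < step_label z w)%O.
Proof.
move=> pos_xy pos_zw; rewrite /step_label pos_xy pos_zw ltEprodlexi /= !leEnat ltEnat /=.
case/orP=> [/andP[lt_qp lt_pn]|/andP[/eqP-> ->]]; last by rewrite leqnn implybT.
have lt_sub : n - p < n - q by apply: ltn_sub2l => //; apply: ltn_trans lt_pn.
by rewrite (ltnW lt_sub) leqNgt lt_sub.
Qed.

Lemma coated_EL_labeling : EL_labeling step_label.
Proof.
apply: EL_criterion => x y lt_xy; have [p [lt_p eq_gt]] := last_difference lt_xy.
have le_xy := ltW lt_xy.
have lt_pn := differ_bound lt_p.
have [z [cov_xz le_zy lt_z eq_z]] := coated_step le_xy lt_p eq_gt.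
have pos_z : moved x z = p by apply: movedE.
exists z; split=> // w.
- move=> cov_xw le_wy ne_wz; have [q [lt_q eq_w]] := coated_cover cov_xw.
  have pos_w : moved x w = q by apply: movedE.
  have lew := subposet_leP _ _ le_wy.
  (* A step below [y] is at [p] or before, and covers that change the letter
     at [p] only are comparable, hence equal. *)
  have lt_qp : q < p.
    rewrite ltn_neqAle leqNgt; apply/andP; split; last first.
      by apply/negP => /eq_gt e; have := lew q; rewrite -e leqNgt lt_q.
    apply: contraNneq ne_wz => e; rewrite e in lt_q eq_w.
    have [le_zw|lt_wz] := leqP (at_ z p) (at_ w p).
      rewrite (covers_between cov_xw (covers_lt cov_xz)) //.
      apply/subposet_leP => i.
      by have [->|ne] := eqVneq i p; last by rewrite -eq_z ?eq_w.
    rewrite (covers_between cov_xz (covers_lt cov_xw)) //.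
    apply/subposet_leP => i.
    by have [->|ne] := eqVneq i p; [apply: ltnW | rewrite -eq_w ?eq_z].
  have wp : at_ w p = at_ x p by rewrite eq_w // neq_ltn lt_qp orbT.
  split; first by apply: (step_label_lt pos_z pos_w); rewrite lt_qp lt_pn.
  (* The letter at [p] still has to change after [w], with a smaller label. *)
  have [|i lt_pi|v [cov_wv le_vy lt_v eq_v]] := @coated_step w y p le_wy.
  + by rewrite wp.
  + by rewrite -eq_w ?eq_gt // neq_ltn (ltn_trans lt_qp lt_pi) orbT.
  exists v; split=> //; apply: (step_label_lt (movedE lt_v eq_v) pos_w).
  by rewrite lt_qp lt_pn.
- move=> cov_zw le_wy; have [q [lt_q eq_w]] := coated_cover cov_zw.
  have lew := subposet_leP _ _ le_wy.
  have le_qp : q <= p.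
    rewrite leqNgt; apply/negP => lt_pq; have := lew q; have := eq_gt _ lt_pq.
    by rewrite eq_z ?neq_ltn ?lt_pq ?orbT // => <-; rewrite leqNgt lt_q.
  apply: (step_label_lt pos_z (movedE lt_q eq_w)).
  by rewrite lt_pn lt_z !andbT ltn_neqAle le_qp andbT orbC orbN.
Qed.

Lemma coated_EL_shellable :
  (exists b : T, forall x, (b <= x)%O) -> (exists t : T, forall x, (x <= t)%O) ->
  EL_shellable T.
Proof. by move=> bot top; split=> //; do 3 eexists; apply: coated_EL_labeling. Qed.

End Coated.

(** * Canyons as words *)

Section Canyons.
Variable delta : nat -> nat.

(** Canyons as bare words, letters numbered from 0, so that words of different
    sizes can be compared and concatenated. There is no upper bound on [i] in the
    last condition because letters beyond the end read as 0. *)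
Definition canyon_word (n : nat) (w : seq nat) : Prop :=
  [/\ size w = n, forall i, i < n -> nth 0 w i <= delta i.+1
    & forall k i, k < i -> i - k <= nth 0 w i -> nth 0 w k + (i - k) <= nth 0 w i].

Lemma cliff_word n (u : cliff delta n) i :
  i < n -> nth 0 (word u) i <= delta i.+1.
Proof.
have /is_cliffP h : is_cliff delta (word u) by case: u.
by move=> lt_in; have := h (Ordinal lt_in); rewrite (tnth_nth 0).
Qed.

Lemma in_canyons n (u : cliff delta n) :
  reflect (canyon_word n (word u)) (u \in canyons delta n).
Proof.
rewrite inE; apply: (iffP allP) => [h|[_ _ h] i].
  split=> [||k i lt_ki le_ik]; [exact: size_tuple | exact: cliff_word |].
  have lt_in : i < n.
    rewrite ltnNge; apply/negP => le_ni; move: le_ik.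
    by rewrite [nth _ _ _]nth_default ?size_tuple // leqNgt subn_gt0 lt_ki.
  have /h/allP/(_ (i - k)) : i.+1 \in iota 1 n by rewrite mem_iota add1n.
  rewrite mem_iota add1n subn_gt0 lt_ki ltnS => /(_ le_ik).
  rewrite subSn ?leq_subr // (subKn (ltnW lt_ki)) /=.
  by rewrite /letter /=; lia.
rewrite mem_iota add1n ltnS => /andP[i_gt0 le_in]; apply/allP => j.
rewrite mem_iota add1n ltnS => /andP[j_gt0 le_j]; apply/implyP => lt_ji.
have := h (i - j).-1 i.-1; rewrite -/(letter u i) -/(letter u (i - j)).
by rewrite (_ : i.-1 - (i - j).-1 = j); lia.
Qed.

Lemma words_ofP n (w : seq nat) :
  reflect (canyon_word n w) (w \in words_of (canyons delta n)).
Proof.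
apply: (iffP imageP) => [[u /in_canyons ? ->]//|can_w].
have [/eqP size_w bound_w _] := can_w.
have cliff_w : is_cliff delta (Tuple size_w).
  by apply/is_cliffP => i; rewrite (tnth_nth 0); apply: bound_w.
by exists (Cliff cliff_w) => //; apply/in_canyons.
Qed.

Lemma canyon_of_word n w : canyon_word n w ->
  exists x : subposet (canyons delta n), w = word (val x).
Proof. by move=> /words_ofP/imageP[u uP ->]; exists (Sub u uP). Qed.

Lemma canyon_subposet n (x : subposet (canyons delta n)) :
  canyon_word n (word (val x)).
Proof. exact/in_canyons/(valP x). Qed.

(** * Meets, coatedness and bounds *)

Lemma canyons_meet n : meet_subsemilattice (canyons delta n).
Proof.
move=> u v /in_canyons[size_u bu hu] /in_canyons[_ bv hv]; apply/in_canyons.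
have meetE i : nth 0 (word (u `&` v)%O) i = minn (nth 0 (word u) i) (nth 0 (word v) i).
  have [lt_in|le_ni] := ltnP i n; last by rewrite !nth_default ?size_tuple.
  rewrite -!(tnth_nth 0 _ (Ordinal lt_in)).
  exact: (tnth_meet (word u) (word v) (Ordinal lt_in)).
split=> [|i lt_in|k i lt_ki]; first exact: size_tuple.
  by rewrite meetE geq_min bu.
by rewrite !meetE; have := hu _ _ lt_ki; have := hv _ _ lt_ki; lia.
Qed.

Lemma canyons_coated n : coated (canyons delta n).
Proof.
move=> u v /in_canyons[size_u bu hu] /in_canyons[size_v bv hv] /cliff_leP le_uv p.
move=> p_bounds; have lt_pn : p < n by lia.
have graftE i : nth 0 (take p u ++ drop p v) i = nth 0 (if i < p then u else v) i.
  rewrite nth_cat size_take size_tuple lt_pn.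
  by case: ltnP => le_pi; rewrite ?nth_take // nth_drop subnKC.
apply/words_ofP; split=> [|i lt_in|k i lt_ki].
- by rewrite size_cat size_take size_drop !size_tuple lt_pn; lia.
- by rewrite graftE; case: ifP => _; [apply: bu | apply: bv].
rewrite !graftE; have [lt_ip|le_pi] := ltnP i p.
  by rewrite (ltn_trans lt_ki lt_ip); apply: hu.
case: ifP => _; last exact: hv.
by move=> le_i; apply: leq_trans (hv _ _ lt_ki le_i); rewrite leq_add2r.
Qed.

Hypothesis delta_incr : increasing_range_map delta.

(** The canyon inequality for the word of the greatest allowed letters. *)
Lemma range_map_gap k i : k <= i -> delta k.+1 + (i - k) <= delta i.+1.
Proof.
elim: i => [|i IH]; first by rewrite leqn0 => /eqP->; rewrite addn0.
rewrite leq_eqVlt => /predU1P[->|lt_ki]; first by rewrite subnn addn0.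
by have := delta_incr (ltn0Sn i); have := IH lt_ki; lia.
Qed.

Lemma canyon_zero n : canyon_word n (nseq n 0).
Proof.
split=> [|i _|k i lt_ki]; rewrite ?size_nseq ?nth_nseq ?if_same //.
Qed.

Lemma canyon_top n : canyon_word n (mkseq (fun i => delta i.+1) n).
Proof.
split=> [|i lt_in|k i lt_ki]; first by rewrite size_mkseq.
  by rewrite nth_mkseq.
have [lt_in _|le_ni] := ltnP i n.
  by rewrite !nth_mkseq ?(ltn_trans lt_ki lt_in) //; apply: range_map_gap; apply: ltnW.
by rewrite (nth_default _ (s := mkseq _ _) (n := i)) ?size_mkseq // leqn0 subn_eq0 leqNgt lt_ki.
Qed.

Lemma canyons_bottom n :
  exists b : subposet (canyons delta n), forall x, (b <= x)%O.
Proof.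
have [b def_b] := canyon_of_word (canyon_zero n); exists b => x.
by apply/subposet_leP => i; rewrite -def_b nth_nseq if_same.
Qed.

Lemma canyons_top n :
  exists t : subposet (canyons delta n), forall x, (x <= t)%O.
Proof.
have [t def_t] := canyon_of_word (canyon_top n); exists t => x.
apply/subposet_leP => i; rewrite -def_t.
have [lt_in|le_ni] := ltnP i n; last by rewrite nth_default ?size_tuple.
by rewrite nth_mkseq // cliff_word.
Qed.

Lemma canyons_lattice n : is_lattice (subposet (canyons delta n)).
Proof.
have [t tP] := canyons_top n; apply: (meets_top_lattice tP) => x y.
have meet_xy := canyons_meet (valP x) (valP y).
exists (Sub (val x `&` val y)%O meet_xy : subposet (canyons delta n)) => z.
have leE (u v : subposet (canyons delta n)) : (u <= v)%O = (val u <= val v)%O.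
  by rewrite -Order.le_val.
by rewrite !leE /= Order.lexI.
Qed.


(** * Appending a last letter *)

Definition word_le (s t : seq nat) : Prop := forall i, nth 0 s i <= nth 0 t i.

(** The bounds that a last letter [a] puts on the letters of the word [w] of
    size [n] that precedes it. *)
Definition fits (n a : nat) (w : seq nat) : Prop :=
  forall k, k < n -> n - k <= a -> nth 0 w k + (n - k) <= a.

Lemma word_le_rcons v w a b : size v = size w ->
  word_le (rcons v a) (rcons w b) <-> word_le v w /\ a <= b.
Proof.
move=> eq_size; split=> [le_ab|[le_vw le_ab] i]; last first.
  by rewrite !nth_rcons eq_size; case: ifP => // _; case: ifP.
split=> [i|]; last by have := le_ab (size v); rewrite !nth_rcons eq_size ltnn eqxx.
have [lt_i|le_i] := ltnP i (size v); last by rewrite nth_default.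
by have := le_ab i; rewrite !nth_rcons -eq_size lt_i.
Qed.

Lemma fits_le n a v w : word_le v w -> fits n a w -> fits n a v.
Proof.
move=> le_vw fit_w k lt_kn le_a; apply: leq_trans (fit_w k lt_kn le_a).
by rewrite leq_add2r.
Qed.

Lemma canyon_rcons n w a :
  canyon_word n.+1 (rcons w a) <->
  [/\ canyon_word n w, a <= delta n.+1 & fits n a w].
Proof.
split=> [[/eqP]|[[size_w bw hw] le_a fit_a]].
  rewrite size_rcons eqSS => /eqP size_w b_wa h_wa.
  have nthE i : i < n -> nth 0 (rcons w a) i = nth 0 w i.
    by rewrite nth_rcons size_w => ->.
  have nth_n : nth 0 (rcons w a) n = a by rewrite nth_rcons size_w ltnn eqxx.
  split; [split=> // [i lt_in|k i lt_ki] | by rewrite -{1}nth_n b_wa |].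
  - by rewrite -nthE // b_wa // ltnW.
  - have [lt_in|le_ni] := ltnP i n; last by rewrite [nth _ _ i]nth_default ?size_w //; lia.
    by rewrite -!nthE ?(ltn_trans lt_ki) //; apply: h_wa.
  - by move=> k lt_kn; rewrite -{1 2}nth_n -(nthE k) //; apply: h_wa.
split=> [|i|k i lt_ki]; first by rewrite size_rcons size_w.
  rewrite ltnS leq_eqVlt nth_rcons size_w => /predU1P[->|lt_in].
    by rewrite ltnn eqxx.
  by rewrite lt_in bw.
rewrite !nth_rcons size_w; case: (ltngtP i n) => [lt_in|lt_ni|eq_in].
- by rewrite (ltn_trans lt_ki lt_in); apply: hw.
- lia.
by rewrite eq_in in lt_ki *; rewrite lt_ki; apply: fit_a.
Qed.

Lemma canyon_rconsP n v : canyon_word n.+1 v ->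
  exists w a, [/\ v = rcons w a, canyon_word n w, a <= delta n.+1 & fits n a w].
Proof.
case/lastP: v => [[]|w a] // can_v; exists w, a.
by have [] := (canyon_rcons n w a).1 can_v.
Qed.

(** The greatest canyon of size [n] that can be followed by [a]. *)
Definition cap (n a : nat) : seq nat :=
  mkseq (fun k => if n - k <= a then minn (delta k.+1) (a - (n - k)) else delta k.+1) n.

(** Where the letter is cut to [a - (n - k)], stepping back by one lowers the
    cut by one; where it is not, the gaps of [delta] suffice. *)
Lemma canyon_cap n a : canyon_word n (cap n a).
Proof.
split=> [|i lt_in|k i lt_ki]; first by rewrite size_mkseq.
  by rewrite nth_mkseq //; case: ifP; rewrite // geq_minl.
have [lt_in|le_ni] := ltnP i n.
  rewrite !nth_mkseq ?(ltn_trans lt_ki) //.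
  have := range_map_gap (ltnW lt_ki).
  by do 2 case: ifP => ?; lia.
by rewrite [nth _ _ i]nth_default ?size_mkseq //; lia.
Qed.

Lemma fitsP n a w : canyon_word n w -> fits n a w <-> word_le w (cap n a).
Proof.
move=> [size_w bw _]; split=> [fit_w i|le_w k lt_kn le_a]; last first.
  by have := le_w k; rewrite nth_mkseq // le_a; lia.
have [lt_in|le_ni] := ltnP i n; last by rewrite nth_default ?size_w.
rewrite nth_mkseq //; case: ifP => [le_a|_]; last exact: bw.
by have := fit_w i lt_in le_a; have := bw i lt_in; lia.
Qed.

(** The last letter [delta n.+1] is large enough to allow any canyon. *)
Lemma fits_range n w : canyon_word n w -> fits n (delta n.+1) w.
Proof.
move=> [_ bw _] k lt_kn _; apply: leq_trans (range_map_gap (ltnW lt_kn)).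
by rewrite leq_add2r bw.
Qed.

Lemma word_le_zero n w : word_le (nseq n 0) w.
Proof. by move=> i; rewrite nth_nseq if_same. Qed.

Lemma canyon_zero_rcons n a : a <= delta n.+1 -> canyon_word n.+1 (rcons (nseq n 0) a).
Proof.
move=> le_a; apply/canyon_rcons; split=> //; first exact: canyon_zero.
by move=> k _; rewrite nth_nseq if_same.
Qed.

(** The maximum is reached by a word of zeros followed by [delta n.+1]. *)
Lemma max_letter_canyons n : max_letter (canyons delta n.+1) = delta n.+1.
Proof.
apply/eqP; rewrite eqn_leq; apply/andP; split.
  by apply/bigmax_leqP => u _; apply: cliff_word.
have [x def_x] := canyon_of_word (canyon_zero_rcons (leqnn (delta n.+1))).
rewrite (leq_trans _ (leq_bigmax_cond _ (valP x))) //.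
by rewrite /letter -def_x nth_rcons size_nseq ltnn eqxx.
Qed.

Lemma relast_canyonsP n a b (s : seq nat) :
  reflect (exists2 w, canyon_word n.+1 (rcons w a) & s = rcons w b)
          (s \in relast (canyons delta n.+1) a b).
Proof.
apply: (iffP imageP) => [[u]|[w can_wa ->]].
  rewrite inE => /andP[/in_canyons can_u]; have := can_u; rewrite /letter.
  have [w [c [-> [size_w _ _] _ _]]] := canyon_rconsP can_u.
  rewrite nth_rcons size_w ltnn eqxx => can_wc /eqP eq_c ->.
  by exists w; rewrite -?eq_c // -[rcons w c]cats1 take_size_cat.
have [[size_w _ _] _ _] := (canyon_rcons n w a).1 can_wa.
have [x def_x] := canyon_of_word can_wa; exists (val x).
  by rewrite inE (valP x) /letter -def_x /= nth_rcons size_w ltnn eqxx.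
by rewrite -def_x -[rcons w a]cats1 take_size_cat.
Qed.

(** The interval runs from [0 .. 0 m] to [cap n a] followed by [m]; a canyon
    between these two words ends with [m]. *)
Lemma canyons_nested n : nested (canyons delta n.+1).
Proof.
move=> a; rewrite max_letter_canyons => le_a.
set m := delta n.+1.
have raise w : canyon_word n.+1 (rcons w a) -> canyon_word n.+1 (rcons w m).
  by case/canyon_rcons=> can_w _ _; apply/canyon_rcons; split=> //; apply: fits_range.
split; first exact/words_ofP/canyon_zero_rcons.
  by move=> s /relast_canyonsP[w /raise can_w ->]; apply/words_ofP.
have [x def_x] := canyon_of_word (canyon_zero_rcons (leqnn m)).
have can_cap : canyon_word n.+1 (rcons (cap n a) m).
  by apply/canyon_rcons; split; [apply: canyon_cap | | apply/fits_range/canyon_cap].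
have [y def_y] := canyon_of_word can_cap.
exists (val x), (val y); split; [exact: valP | exact: valP |] => s.
have size0 w : canyon_word n w -> size (nseq n 0) = size w.
  by case=> -> _ _; rewrite size_nseq.
have sizeC w : canyon_word n w -> size w = size (cap n a).
  by case=> -> _ _; rewrite size_mkseq.
apply/relast_canyonsP/imageP => [[w can_wa ->]|[z]].
  have [can_w _ fit_w] := (canyon_rcons n w a).1 can_wa.
  have [z def_z] := canyon_of_word (raise w can_wa).
  exists (val z) => //; rewrite inE (valP z) /=.
  apply/andP; split; apply/cliff_leP; rewrite -def_z -?def_x -?def_y.
    by apply/(word_le_rcons _ _ (size0 w can_w)); split=> //; apply: word_le_zero.
  by apply/(word_le_rcons _ _ (sizeC w can_w)); split=> //; apply/fitsP.
rewrite inE => /andP[/in_canyons/canyon_rconsP[w [b [def_z can_w le_b _]]]].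
move=> /andP[/cliff_leP + /cliff_leP]; rewrite -def_x -def_y def_z.
move=> /(word_le_rcons _ _ (size0 w can_w))[_ le_mb].
move=> /(word_le_rcons _ _ (sizeC w can_w))[le_w _] ->.
have -> : b = m by apply/eqP; rewrite eqn_leq le_b.
by exists w => //; apply/canyon_rcons; split=> //; apply/fitsP.
Qed.

(** * Doublings *)

(** Isomorphism with a set of words, without building a type for the
    intermediate sets. Injectivity of [f] follows from the third clause. *)
Definition realizes (d : Order.disp_t) (U : porderType d) (S : seq nat -> Prop) : Prop :=
  exists f : U -> seq nat,
    [/\ forall x, S (f x), forall s, S s -> exists x, f x = s
      & forall x y, (x <= y)%O <-> word_le (f x) (f y)].

Definition doubling_constructible (S : seq nat -> Prop) : Prop :=
  exists (d : Order.disp_t) (U : porderType d), iterated_doubling U /\ realizes U S.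

Lemma doubling_constructible_ext (S S' : seq nat -> Prop) :
  (forall s, S s <-> S' s) -> doubling_constructible S -> doubling_constructible S'.
Proof.
move=> eqS [d [U [itU [f [fS f_onto f_le]]]]]; exists d, U; split=> //.
by exists f; split=> // [x|s /eqS/f_onto //]; apply/eqS.
Qed.

Lemma empty_word_constructible : doubling_constructible (canyon_word 0).
Proof.
do 2 eexists; split; first exact: doubling_one.
exists (fun=> [::]); split=> [x|s [/size0nil -> _ _]|x y].
- exact: (canyon_zero 0).
- by exists ord0.
- by rewrite !ord1 lexx; split=> // _ i; rewrite leqnn.
Qed.

(** The canyons obtained from those ending with [delta n.+1] after adding the
    ones whose last letter is less than [a]. *)
Definition layer (n a : nat) (v : seq nat) : Prop :=
  canyon_word n.+1 v /\ (nth 0 v n < a \/ nth 0 v n = delta n.+1).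

Lemma layerP n a w b : size w = n ->
  layer n a (rcons w b) <-> canyon_word n.+1 (rcons w b) /\ (b < a \/ b = delta n.+1).
Proof. by move=> size_w; rewrite /layer nth_rcons size_w ltnn eqxx. Qed.

Lemma layer0_constructible n :
  doubling_constructible (canyon_word n) -> doubling_constructible (layer n 0).
Proof.
move=> [d [U [itU [f [fS f_onto f_le]]]]]; exists d, U; split=> //.
exists (fun x => rcons (f x) (delta n.+1)); split=> [x|s [can_s last_s]|x y].
- have [size_x _ _] := fS x; apply/layerP => //; split; last by right.
  by apply/canyon_rcons; split=> //; apply: fits_range.
- case: (canyon_rconsP can_s) last_s => w [a [-> can_w _ _]].
  have [size_w _ _] := can_w; rewrite nth_rcons size_w ltnn eqxx.
  by case=> // ->; have [x <-] := f_onto w can_w; exists x.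
have eq_size : size (f x) = size (f y) by have [-> _ _] := fS x; have [-> _ _] := fS y.
rewrite f_le; split=> [le_xy|/(word_le_rcons _ _ eq_size)[]//].
by apply/word_le_rcons.
Qed.

(** The doubled interval consists of the words [w m] such that [w a] is a canyon.
    Its lower copy of [w m] becomes [w a], everything else is kept. The order
    is right because the interval is closed downwards among the words ending
    with [m], and the remaining words end with less than [a]. *)
Lemma layerS_constructible n a : a < delta n.+1 ->
  doubling_constructible (layer n a) -> doubling_constructible (layer n a.+1).
Proof.
set m := delta n.+1 => lt_am [d [U [itU [f [fS f_onto f_le]]]]].
have fE x : exists w b, [/\ f x = rcons w b, canyon_word n w, b <= m, fits n b w & b < a \/ b = m].
  have [/canyon_rconsP[w [b [fx can_w le_b fit_b]]]] := fS x.
  have [size_w _ _] := can_w; rewrite fx nth_rcons size_w ltnn eqxx => b_cases.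
  by exists w, b.
have ex_top w : canyon_word n w -> exists x, f x = rcons w m.
  move=> can_w; apply: f_onto; apply/layerP; first by case: can_w.
  by split; [apply/canyon_rcons; split=> //; apply: fits_range | right].
have [lo f_lo] := ex_top _ (canyon_zero n).
have [hi f_hi] := ex_top _ (canyon_cap n a).
have le_rcons v w b c : canyon_word n v -> canyon_word n w ->
    word_le (rcons v b) (rcons w c) <-> word_le v w /\ b <= c.
  by move=> [size_v _ _] [size_w _ _]; apply: word_le_rcons; rewrite size_v.
have itvP x w b : f x = rcons w b -> canyon_word n w -> b <= m ->
    in_itv lo hi x <-> b = m /\ fits n a w.
  move=> fx can_w le_b; split=> [/andP[/f_le + /f_le]|[eq_b fit_w]].
    rewrite f_lo f_hi fx => /(le_rcons _ _ _ _ (canyon_zero n) can_w)[_ le_mb].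
    move=> /(le_rcons _ _ _ _ can_w (canyon_cap n a))[/fitsP fit_w _].
    by split; [apply/eqP; rewrite eqn_leq le_b | apply: fit_w].
  apply/andP; split; apply/f_le; rewrite fx ?f_lo ?f_hi eq_b.
    by apply/(le_rcons _ _ _ _ (canyon_zero n) can_w); split=> //; apply: word_le_zero.
  by apply/(le_rcons _ _ _ _ can_w (canyon_cap n a)); split=> //; apply/fitsP.
have itv_word x : in_itv lo hi x -> exists w, [/\ f x = rcons w m, canyon_word n w & fits n a w].
  have [w [b [fx can_w le_b _ _]]] := fE x.
  by move=> /(itvP _ _ _ fx can_w le_b)[eq_b fit_w]; exists w; rewrite -eq_b.
pose g (p : doubling lo hi) := match p with
  | inr (x, false) => rcons (take n (f (val x))) a
  | _ => f (under p) end.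
have gE (x : {x : U | in_itv lo hi x}) : exists w,
    [/\ f (val x) = rcons w m, g (inr (x, false)) = rcons w a, canyon_word n w
      & fits n a w].
  have [w [fx can_w fit_w]] := itv_word _ (valP x); exists w; split=> //=.
  by have [size_w _ _] := can_w; rewrite fx -[rcons w m]cats1 take_size_cat.
exists d, (doubling lo hi); split.
  apply: doubling_step => //; apply/f_le; rewrite f_lo f_hi.
  apply/(le_rcons _ _ _ _ (canyon_zero n) (canyon_cap n a)).
  by split=> //; apply: word_le_zero.
have layer_mono s : layer n a s -> layer n a.+1 s.
  by case=> can_s [/ltnW lt_a|eq_m]; split=> //; [left|right].
exists g; split.
- move=> [x|[x []]]; try exact: layer_mono (fS _).
  have [w [_ -> can_w fit_w]] := gE x; have [size_w _ _] := can_w.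
  apply/layerP => //; split; last by left.
  by apply/canyon_rcons; split=> //; apply: ltnW.
- move=> s layer_s; have [can_s last_s] := layer_s.
  have [w [b [def_s can_w le_b fit_w]]] := canyon_rconsP can_s.
  have [size_w _ _] := can_w.
  have [eq_ba|ne_ba] := eqVneq b a.
    have [x fx] := ex_top w can_w.
    have itv_x : in_itv lo hi x by apply/(itvP _ _ _ fx can_w); rewrite -?eq_ba.
    have [w' [fx' gx _ _]] := gE (exist _ x itv_x).
    exists (inr (exist _ x itv_x, false)); rewrite gx def_s eq_ba.
    by move: fx'; rewrite /= fx => /rcons_inj[->].
  have /f_onto[x fx] : layer n a s.
    split=> //; move: last_s; rewrite def_s nth_rcons size_w ltnn eqxx.
    by rewrite ltnS leq_eqVlt (negbTE ne_ba).
  have [itv_x|itv_x] := boolP (in_itv lo hi x).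
    by exists (inr (exist _ x itv_x, true)).
  by exists (inl (exist _ x itv_x)).
(* Below a new word [w a] are the old words below [w m] that are outside of
   the interval, all of which end with less than [a]. *)
have up x y w : f y = rcons w m -> canyon_word n w -> fits n a w ->
    word_le (f x) (rcons w a) <-> (x <= y)%O && ~~ in_itv lo hi x.
  move=> fy can_w fit_w; have [v [b [fx can_v le_b fit_v b_cases]]] := fE x.
  rewrite fx; split=> [/(le_rcons _ _ _ _ can_v can_w)[le_vw le_ba]|/andP[/f_le]].
    apply/andP; split.
      by apply/f_le; rewrite fx fy; apply/le_rcons.
    by apply/negP => /(itvP _ _ _ fx can_v le_b)[eq_b _]; move: le_ba; rewrite eq_b leqNgt lt_am.
  rewrite fx fy => /(le_rcons _ _ _ _ can_v can_w)[le_vw _] out_x.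
  apply/le_rcons => //; split=> //.
  case: b_cases => [/ltnW//|eq_b]; case/negP: out_x.
  by apply/(itvP _ _ _ fx can_v le_b); split=> //; apply: fits_le fit_w.
(* Above a new word [w a] are the old words above [w m]: an old word that ends
   with at least [a] ends with [m]. *)
have down x y w : f x = rcons w m -> canyon_word n w ->
    word_le (rcons w a) (f y) <-> (x <= y)%O.
  move=> fx can_w; have [v [b [fy can_v le_b _ b_cases]]] := fE y.
  rewrite f_le fx fy; split=> /(le_rcons _ _ _ _ can_w can_v)[le_wv le_ab]; apply/le_rcons => //.
    by split=> //; case: b_cases => [|->//]; rewrite ltnNge le_ab.
  by split=> //; apply: leq_trans le_ab; apply: ltnW.
have leE (p q : doubling lo hi) : (p <= q)%O = doubling_le p q by [].
move=> p q; rewrite leE /doubling_le.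
case: p q => [x|[x [] ]] [y|[y [] ]]; rewrite ?andbT ?andbF.
1,2,4,5: exact: f_le.
- have [w [fy gy can_w fit_w]] := gE y; rewrite gy; apply: iff_sym.
  by have := up (val x) _ _ fy can_w fit_w; rewrite (negbTE (valP x)) andbT.
- have [w [fy gy can_w fit_w]] := gE y; rewrite gy; apply: iff_sym.
  by have := up (val x) _ _ fy can_w fit_w; rewrite (valP x) !andbF.
- have [w [fx gx can_w _]] := gE x; rewrite gx; apply: iff_sym.
  exact: down.
- have [w [fx gx can_w _]] := gE x; rewrite gx; apply: iff_sym.
  exact: down.
have [v [fx gx can_v _]] := gE x; have [w [fy gy can_w _]] := gE y.
rewrite gx gy f_le /= fx fy.
by split=> /(le_rcons _ _ _ _ can_v can_w)[le_vw _]; apply/le_rcons.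
Qed.

Lemma canyon_words_constructible n : doubling_constructible (canyon_word n).
Proof.
elim: n => [|n IH]; first exact: empty_word_constructible.
have layers a : a <= delta n.+1 -> doubling_constructible (layer n a).
  elim: a => [_|a IHa lt_a]; first exact: layer0_constructible.
  exact: layerS_constructible lt_a (IHa (ltnW lt_a)).
apply: doubling_constructible_ext (layers _ (leqnn _)) => v.
split=> [[]//|can_v]; split=> //.
have [_ bound_v _] := can_v; have := bound_v n (ltnSn n).
by rewrite leq_eqVlt => /predU1P[]; [right|left].
Qed.

Lemma canyons_doubling n :
  constructible_by_interval_doubling (subposet (canyons delta n)).
Proof.
have [d [U [itU [f [f_can f_onto f_le]]]]] := canyon_words_constructible n.
exists d, U; split=> //.
have exF x : exists z : subposet (canyons delta n), f x == word (val z).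
  by have [z ->] := canyon_of_word (f_can x); exists z.
have exG (z : subposet (canyons delta n)) : exists x, f x == word (val z).
  by have [x <-] := f_onto _ (canyon_subposet z); exists x.
pose F x := xchoose (exF x); pose G z := xchoose (exG z).
have FE x : f x = word (val (F x)) by apply/eqP/(xchooseP (exF x)).
have GE z : f (G z) = word (val z) by apply/eqP/(xchooseP (exG z)).
have F_mono : {mono F : x y / (x <= y)%O}.
  move=> x y; apply/subposet_leP/idP => [le_xy|/f_le le_xy i].
    by apply/f_le => i; rewrite !FE.
  by rewrite -!FE.
exists F => //; exists G => [x|z].
  by apply/le_anti/andP; split; apply/f_le; rewrite GE -FE => i.
by apply/subposet_ext => i; rewrite -FE GE.
Qed.

End Canyons.

Theorem proposition2p3p7 (delta : nat -> nat) (n : nat)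
    (hdelta : increasing_range_map delta) :
  straight (canyons delta n) /\
  coated (canyons delta n) /\
  (0 < n -> nested (canyons delta n)) /\
  EL_shellable (subposet (canyons delta n)) /\
  meet_subsemilattice (canyons delta n) /\
  is_lattice (subposet (canyons delta n)) /\
  constructible_by_interval_doubling (subposet (canyons delta n)).
Proof.
have coatedP := @canyons_coated delta n.
split; first exact: coated_straight.
split=> //; split; first by case: n {coatedP} => // n _; apply: canyons_nested.
split; first by apply: coated_EL_shellable => //; [apply: canyons_bottom | apply: canyons_top].
split; first exact: canyons_meet.
by split; [apply: canyons_lattice | apply: canyons_doubling].
Qed.
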